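(* Let $M\ge0$, let $m\ge1$ be an integer, and let $\mathcal{G}_0:=\frac{\mu^2}{3L+M}$. Assume that $\|\nabla f(\mathbf{x}_0)\|_*\le\frac12\mathcal{G}_0$. Then the iterates of the Cubic Newton method with Lazy Hessians (with parameters $m$ and $M$) started at $\mathbf{x}_0$ satisfy, for all $k\ge0$, $$\|\nabla f(\mathbf{x}_k)\|_*\;\le\;\mathcal{G}_0\cdot\Bigl(\frac12\Bigr)^{(1+m)^{\pi(k)/m}\,(1+(k\bmod m))}.$$
   Context: $\mathbf{B}\in\mathbb{R}^{d\times d}$ is a fixed symmetric positive definite matrix, $\|\mathbf{x}\|=\langle \mathbf{B}\mathbf{x},\mathbf{x}\rangle^{1/2}$, $\|\mathbf{g}\|_*=\langle \mathbf{g},\mathbf{B}^{-1}\mathbf{g}\rangle^{1/2}$ for gradients, and $\|\mathbf{A}\|=\sup_{\|\mathbf{x}\|\le1}\|\mathbf{A}\mathbf{x}\|_*$ for matrices. The function $f:\mathbb{R}^d\to\mathbb{R}$ is twice continuously differentiable, $\|\nabla^2 f(\mathbf{x})-\nabla^2 f(\mathbf{y})\|\le L\|\mathbf{x}-\mathbf{y}\|$ for all $\mathbf{x},\mathbf{y}$ with $L>0$, and $f$ is strongly convex: $\nabla^2 f(\mathbf{x})\succeq\mu\mathbf{B}$ for all $\mathbf{x}\in\mathbb{R}^d$, with $\mu>0$. For $M\ge0$, $\mathbf{T}_M(\mathbf{x},\mathbf{z})$ denotes the (unique, by strong convexity) minimizer over $\mathbf{y}\in\mathbb{R}^d$ of $\langle\nabla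 f(\mathbf{x}),\mathbf{y}-\mathbf{x}\rangle+\frac12\langle\nabla^2 f(\mathbf{z})(\mathbf{y}-\mathbf{x}),\mathbf{y}-\mathbf{x}\rangle+\frac M6\|\mathbf{y}-\mathbf{x}\|^3$; for $M=0$ this is the pure Newton step with Hessian taken at $\mathbf{z}$. Cubic Newton with Lazy Hessians: for $k=0,1,\dots$ set $\mathbf{z}_k=\mathbf{x}_{\pi(k)}$ and $\mathbf{x}_{k+1}=\mathbf{T}_M(\mathbf{x}_k,\mathbf{z}_k)$, where $\pi(k)=k-(k\bmod m)$ is the largest multiple of $m$ not exceeding $k$, so that $\pi(k)/m$ is the number of completed phases. *)

(* Defs.v *)
From HB Require Import structures.
From mathcomp Require Import all_boot all_order all_algebra.
From mathcomp Require Import all_classical all_reals all_analysis.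

Set Implicit Arguments.
Unset Strict Implicit.
Unset Printing Implicit Defensive.

Import Order.TTheory GRing.Theory Num.Theory.
Import numFieldNormedType.Exports.

Local Open Scope classical_set_scope.
Local Open Scope ring_scope.

(* Vectors of R^d are row vectors, and a matrix A acts on them as the linear
   map x |-> x *m A: this is the convention under which the library's jacobian
   represents the derivative ('D_v g x = v *m 'J g x). *)
Definition dot (R : realType) (d : nat) (x y : 'rV[R]_d) : R :=
  \sum_(i < d) x 0 i * y 0 i.

Definition posdefmx (R : realType) (d : nat) (B : 'M[R]_d) : Prop :=
  B^T = B /\ forall x : 'rV[R]_d, x != 0 -> 0 < dot (x *m B) x.

Definition loewner_le (R : realType) (d : nat) (A C : 'M[R]_d) : Prop :=
  forall x : 'rV[R]_d, dot (x *m A) x <= dot (x *m C) x.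

Definition pnorm (R : realType) (d : nat) (B : 'M[R]_d) (x : 'rV[R]_d) : R :=
  Num.sqrt (dot (x *m B) x).

Definition dnorm (R : realType) (d : nat) (B : 'M[R]_d) (g : 'rV[R]_d) : R :=
  Num.sqrt (dot g (g *m invmx B)).

(* For positive definite B the set below is nonempty and bounded, so that
   [sup] is a genuine supremum. *)
Definition opnorm (R : realType) (d : nat) (B A : 'M[R]_d) : R :=
  sup [set dnorm B (x *m A) | x in [set x : 'rV[R]_d | pnorm B x <= 1]].

Definition grad (R : realType) (d : nat) (f : 'rV[R]_d -> R) (x : 'rV[R]_d) :
    'rV[R]_d :=
  \row_(i < d) 'D_(delta_mx 0 i) f x.

Definition hess (R : realType) (d : nat) (f : 'rV[R]_d -> R) (x : 'rV[R]_d) :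
    'M[R]_d :=
  'J (grad f) x.

Definition C2 (R : realType) (d : nat) (f : 'rV[R]_d -> R) : Prop :=
  [/\ forall x, differentiable f x,
      forall x, differentiable (grad f) x
    & continuous (hess f)].

Definition hess_lipschitz (R : realType) (d : nat) (B : 'M[R]_d) (L : R)
    (f : 'rV[R]_d -> R) : Prop :=
  forall x y, opnorm B (hess f x - hess f y) <= L * pnorm B (x - y).

Definition strongly_convex (R : realType) (d : nat) (B : 'M[R]_d) (mu : R)
    (f : 'rV[R]_d -> R) : Prop :=
  forall x, loewner_le (mu *: B) (hess f x).

Definition cubic_model (R : realType) (d : nat) (B : 'M[R]_d) (M : R)
    (f : 'rV[R]_d -> R) (x z y : 'rV[R]_d) : R :=
  dot (grad f x) (y - x) + 2^-1 * dot ((y - x) *m hess f z) (y - x)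
  + M / 6 * pnorm B (y - x) ^+ 3.

(* [T = T_M(x, z)]; the minimizer exists and is unique when [f] is strongly
   convex. *)
Definition is_cubic_step (R : realType) (d : nat) (B : 'M[R]_d) (M : R)
    (f : 'rV[R]_d -> R) (x z T : 'rV[R]_d) : Prop :=
  forall y, cubic_model B M f x z T <= cubic_model B M f x z y.

Definition phase_start (m k : nat) : nat := (k - k %% m)%N.

Definition lazy_cubic_newton (R : realType) (d : nat) (B : 'M[R]_d) (M : R)
    (m : nat) (f : 'rV[R]_d -> R) (x : nat -> 'rV[R]_d) : Prop :=
  forall k, is_cubic_step B M f (x k) (x (phase_start m k)) (x k.+1).

(* Main.v *)
(* Put h = T_M(x,z) - x and H = hess f z. The first-order condition
   grad f(x) + H h + (M/2)|h| B h = 0 and strong convexity give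
   mu |h| <= |grad f(x)|_*, while the mean value theorem and the Lipschitz
   Hessian give |grad f(x+h) - grad f(x) - H h|_* <= L |h| (|h| + |x-z|).
   Since strong convexity also gives mu |x-z| <= |grad f(x)|_* + |grad f(z)|_*,
   mu^2 |grad f(x+h)|_* <= (2L + M/2) a^2 + L a b
   with a = |grad f(x)|_*, b = |grad f(z)|_*. If b <= G0 q and
   a <= G0 q^(1+j), with 0 <= q <= 1, the right-hand side is at most
   mu^2 G0 q^(2+j). The mean value theorem loses a factor 2 on the term
   L |h|^2 compared with integration; the constant 3L + M absorbs it. *)

Require Import Defs.
From HB Require Import structures.
From mathcomp Require Import all_boot all_order all_algebra.
From mathcomp Require Import all_classical all_reals all_analysis.
From mathcomp Require Import ring lra zify.
Import Order.TTheory GRing.Theory Num.Theory.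
Import numFieldNormedType.Exports.
Local Open Scope ring_scope.

Set Implicit Arguments.
Unset Strict Implicit.
Unset Printing Implicit Defensive.

(** * Energy norm and its dual *)

Section Dot.
Variables (R : realType) (d : nat).
Implicit Types (x y z : 'rV[R]_d) (A : 'M[R]_d).

Lemma dotE x y : dot x y = (x *m y^T) 0 0.
Proof. by rewrite /dot mxE; apply: eq_bigr => i _; rewrite mxE. Qed.

Lemma dotC x y : dot x y = dot y x.
Proof. by apply: eq_bigr => i _; rewrite mulrC. Qed.

Lemma dotDl x y z : dot (x + y) z = dot x z + dot y z.
Proof. by rewrite !dotE mulmxDl mxE. Qed.

Lemma dotZl a x z : dot (a *: x) z = a * dot x z.
Proof. by rewrite !dotE -scalemxAl mxE. Qed.

Lemma dotNl x z : dot (- x) z = - dot x z.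
Proof. by rewrite -scaleN1r dotZl mulN1r. Qed.

Lemma dotBl x y z : dot (x - y) z = dot x z - dot y z.
Proof. by rewrite dotDl dotNl. Qed.

Lemma dotDr x y z : dot z (x + y) = dot z x + dot z y.
Proof. by rewrite dotC dotDl !(dotC z). Qed.

Lemma dotZr a x z : dot z (a *: x) = a * dot z x.
Proof. by rewrite dotC dotZl dotC. Qed.

Lemma dotNr x z : dot z (- x) = - dot z x.
Proof. by rewrite dotC dotNl dotC. Qed.

Lemma dotBr x y z : dot z (x - y) = dot z x - dot z y.
Proof. by rewrite dotDr dotNr. Qed.

Lemma dot0l z : dot 0 z = 0.
Proof. by rewrite dotE mul0mx mxE. Qed.

Lemma dot_mull x y A : dot (x *m A) y = dot x (y *m A^T).
Proof. by rewrite !dotE trmx_mul trmxK mulmxA. Qed.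

End Dot.

Section EnergyNorm.
Variables (R : realType) (d : nat) (B : 'M[R]_d).
Hypothesis Bpos : posdefmx B.
Implicit Types (x y z g v : 'rV[R]_d) (A : 'M[R]_d).

Lemma posdef_dotC x y : dot (x *m B) y = dot (y *m B) x.
Proof. by rewrite dot_mull (proj1 Bpos) dotC. Qed.

Lemma posdef_dot_ge0 x : 0 <= dot (x *m B) x.
Proof.
have [->|/(proj2 Bpos)/ltW//] := eqVneq x 0.
by rewrite mul0mx dot0l.
Qed.

Lemma posdef_unitmx : B \in unitmx.
Proof.
rewrite -row_free_unit -kermx_eq0; apply/rowV0P => x /sub_kermxP xB.
apply/eqP; apply: contraT => /(proj2 Bpos).
by rewrite xB dot0l ltxx.
Qed.

Lemma pnorm_ge0 x : 0 <= pnorm B x.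
Proof. exact: sqrtr_ge0. Qed.

Lemma dualnorm_ge0 g : 0 <= dnorm B g.
Proof. exact: sqrtr_ge0. Qed.

Lemma pnorm_sqr x : pnorm B x ^+ 2 = dot (x *m B) x.
Proof. by rewrite sqr_sqrtr // posdef_dot_ge0. Qed.

Lemma pnorm0_eq0 x : pnorm B x = 0 -> x = 0.
Proof.
move=> nx; apply/eqP; apply: contraT => /(proj2 Bpos).
by rewrite -pnorm_sqr nx expr0n ltxx.
Qed.

Lemma pnorm0 : pnorm B 0 = 0.
Proof. by rewrite /pnorm mul0mx dot0l sqrtr0. Qed.

Lemma pnormZ a x : pnorm B (a *: x) = `|a| * pnorm B x.
Proof.
rewrite /pnorm -scalemxAl dotZl dotZr mulrA -expr2 sqrtrM ?sqr_ge0 //.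
by rewrite sqrtr_sqr.
Qed.

Lemma pnormN x : pnorm B (- x) = pnorm B x.
Proof. by rewrite -scaleN1r pnormZ normrN1 mul1r. Qed.

Lemma pnorm_cauchy x y : dot (x *m B) y <= pnorm B x * pnorm B y.
Proof.
have [/pnorm0_eq0 ->|nx] := eqVneq (pnorm B x) 0.
  by rewrite mul0mx dot0l pnorm0 mul0r.
have [/pnorm0_eq0 ->|ny] := eqVneq (pnorm B y) 0.
  by rewrite dotC dot0l pnorm0 mulr0.
have xp : 0 < pnorm B x by rewrite lt0r nx pnorm_ge0.
have yp : 0 < pnorm B y by rewrite lt0r ny pnorm_ge0.
(* Expanding this square gives [2 |x| |y| (|x| |y| - <Bx, y>) >= 0]. *)
have := posdef_dot_ge0 (pnorm B y *: x - pnorm B x *: y).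
rewrite mulmxBl -!scalemxAl !(dotBl, dotBr, dotZl, dotZr).
rewrite (posdef_dotC y x) -!pnorm_sqr.
move: (dot _ _) => c h.
rewrite -(ler_pM2l (mulr_gt0 xp yp)); nra.
Qed.

Lemma pnormD x y : pnorm B (x + y) <= pnorm B x + pnorm B y.
Proof.
rewrite -(@ler_pXn2r _ 2) ?nnegrE ?addr_ge0 ?pnorm_ge0 //.
rewrite pnorm_sqr mulmxDl !(dotDl, dotDr) (posdef_dotC y x) -!pnorm_sqr.
have := pnorm_cauchy x y; nra.
Qed.

Lemma dnormE g : dnorm B g = pnorm B (g *m invmx B).
Proof. by rewrite /dnorm /pnorm mulmxKV ?posdef_unitmx. Qed.

Lemma dot_le_dnorm_pnorm g v : dot g v <= dnorm B g * pnorm B v.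
Proof. by rewrite -{1}(mulmxKV posdef_unitmx g) dnormE pnorm_cauchy. Qed.

(** The test vector [g *m invmx B] attains the dual norm: it pairs with [g] to [|g|_*^2] and has
    energy norm [|g|_*]. *)
Lemma dnorm_le g C :
  0 <= C -> (forall v, dot g v <= C * pnorm B v) -> dnorm B g <= C.
Proof.
move=> C0 /(_ (g *m invmx B)).
rewrite -{1}(mulmxKV posdef_unitmx g) -pnorm_sqr dnormE.
have := pnorm_ge0 (g *m invmx B); nra.
Qed.

Lemma dnormD g v : dnorm B (g + v) <= dnorm B g + dnorm B v.
Proof. by rewrite !dnormE mulmxDl pnormD. Qed.

Lemma dnormZ a g : dnorm B (a *: g) = `|a| * dnorm B g.
Proof. by rewrite !dnormE -scalemxAl pnormZ. Qed.

(* Each coordinate [x_i = <B (B^-1 e_i), x>] is bounded by the energy norm. *)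
Lemma dnorm_mulmx_bounded A :
  exists C, forall x, pnorm B x <= 1 -> dnorm B (x *m A) <= C.
Proof.
exists (\sum_(i < d) dnorm B (delta_mx 0 i) * dnorm B (row i A)) => x x1.
have -> : x *m A = \sum_(i < d) x 0 i *: row i A by exact: mulmx_sum_row.
have dnorm0 : dnorm B 0 = 0 by rewrite dnormE mul0mx pnorm0.
suff : dnorm B (\sum_(i < d) x 0 i *: row i A) <=
    \sum_(i < d) `|x 0 i| * dnorm B (row i A).
  move=> /le_trans; apply; apply: ler_sum => i _.
  apply: ler_wpM2r; first exact: dualnorm_ge0.
  have coordE y : y 0 i = dot (delta_mx 0 i) y.
    rewrite /dot (bigD1 i) //= mxE !eqxx mul1r big1 ?addr0 // => j ji.
    by rewrite mxE (negPf ji) andbF mul0r.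
  have coord_le y : pnorm B y <= 1 -> y 0 i <= dnorm B (delta_mx 0 i).
    move=> y1; rewrite coordE; apply: le_trans (dot_le_dnorm_pnorm _ _) _.
    by rewrite ler_piMr // dualnorm_ge0.
  rewrite ler_norml coord_le // andbT lerNl.
  by have := coord_le (- x); rewrite mxE; apply; rewrite pnormN.
elim/big_ind2 : _ => [|g a h b ga hb|i _]; first by rewrite dnorm0.
- exact: le_trans (dnormD _ _) (lerD ga hb).
- by rewrite dnormZ.
Qed.

(** By homogeneity it suffices to test [x / |x|], and [dnorm_mulmx_bounded] is what makes [sup] an
    upper bound. *)
Lemma dnorm_mulmx_le A x : dnorm B (x *m A) <= opnorm B A * pnorm B x.
Proof.
have [C AC] := dnorm_mulmx_bounded A.
have [/pnorm0_eq0 ->|nx] := eqVneq (pnorm B x) 0.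
  by rewrite mul0mx pnorm0 mulr0 dnormE mul0mx pnorm0.
have xp : 0 < pnorm B x by rewrite lt0r nx pnorm_ge0.
rewrite -ler_pdivrMr //.
apply: ub_le_sup.
  by exists C => _ [y /= y1 <-]; exact: AC.
have i0 : 0 <= (pnorm B x)^-1 by rewrite invr_ge0 pnorm_ge0.
exists ((pnorm B x)^-1 *: x) => /=.
  by rewrite pnormZ ger0_norm // mulVf.
by rewrite -scalemxAl dnormZ ger0_norm // mulrC.
Qed.

End EnergyNorm.

(** * Derivatives along lines *)

Section Calculus.
Variables (R : realType) (d : nat).
Implicit Types (f g : 'rV[R]_d -> R) (x u v w : 'rV[R]_d).

(** Both difference quotients are the same function of the increment, so no chain rule is
    involved. *)
Lemma is_derive_line g x v t dg :
  is_derive (x + t *: v) v g dg -> is_derive t 1 (fun s => g (x + s *: v)) dg.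
Proof.
have E : (fun h : R => h^-1 *: (((fun s => g (x + s *: v)) \o shift t) (h *: 1)
      - g (x + t *: v))) =
    (fun h : R => h^-1 *: ((g \o shift (x + t *: v)) (h *: v)
      - g (x + t *: v))).
  apply/funext => h /=; congr (_ *: (g _ - _)).
  by rewrite scalerDl [h *: 1]mulr1 addrCA.
by case=> dgv dgE; split; [rewrite /derivable E|rewrite -dgE /derive E].
Qed.

Lemma MVT01 (g dg : R -> R) : (forall t : R, is_derive t 1 g (dg t)) ->
  exists2 c, 0 <= c <= 1 & g 1 - g 0 = dg c.
Proof.
move=> gd; have gc : ({within `[0%R, 1%R], continuous g})%classic.
  by apply: derivable_within_continuous => t _; have [] := gd t.
have [c] := @MVT_segment R g dg 0 1 ler01 (fun t _ => gd t) gc.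
by rewrite in_itv /= subr0 mulr1 => c01 gE; exists c.
Qed.

Lemma is_derive_dot_grad f x v :
  differentiable f x -> is_derive x v f (dot (grad f x) v).
Proof.
move=> df; split; first exact: diff_derivable.
rewrite deriveE // [in LHS](row_sum_delta v) linear_sum /dot.
by apply: eq_bigr => i _; rewrite linearZ /= mxE deriveE // mulrC.
Qed.

Lemma is_derive_dot_hess f x v w : differentiable (grad f) x ->
  is_derive x v (fun y => dot (grad f y) w) (dot (v *m hess f x) w).
Proof.
move=> df; have dfv : derivable (grad f) x v by exact: diff_derivable.
rewrite /hess -deriveEjacobian // derive_mx // /dot.
have -> : (fun y => \sum_(i < d) grad f y 0 i * w 0 i) =
    \sum_(i < d) (w 0 i \*: (fun y => grad f y 0 i)).
  by apply/funext => y; rewrite fct_sumE; apply: eq_bigr => i _; rewrite mulrC.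
apply: is_derive_sum => i; rewrite mxE mulrC.
apply: is_deriveZ; apply: derivableP.
by move/derivable_mxP : dfv; exact.
Qed.

End Calculus.

(** * Lipschitz Hessians *)

Section LipschitzHessian.
Variables (R : realType) (d : nat) (B : 'M[R]_d) (f : 'rV[R]_d -> R) (L : R).
Hypotheses (Bpos : posdefmx B) (fC2 : C2 f) (L0 : 0 < L).
Hypothesis fL : hess_lipschitz B L f.
Implicit Types (x y z u v h : 'rV[R]_d).

(** Pairing with a fixed [v] reduces the vector-valued gradient to the scalar mean value theorem;
    [c] depends on [v]. *)
Lemma grad_dot_MVT x h v : exists2 c, 0 <= c <= 1 &
  dot (grad f (x + h) - grad f x) v = dot (h *m hess f (x + c *: h)) v.
Proof.
have [_ dg _] := fC2.
have [c c01] := MVT01 (fun t => is_derive_line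
  (is_derive_dot_hess h v (dg (x + t *: h)))).
by rewrite scale1r scale0r addr0 -dotBl => E; exists c.
Qed.

Lemma grad_residual x z h v :
  dot (grad f (x + h) - grad f x - h *m hess f z) v <=
    L * pnorm B h * (pnorm B h + pnorm B (x - z)) * pnorm B v.
Proof.
have [c /andP[c0 c1] E] := grad_dot_MVT x h v.
rewrite dotBl E -dotBl -mulmxBr.
apply: le_trans (dot_le_dnorm_pnorm Bpos _ _) _.
apply: ler_wpM2r; first exact: pnorm_ge0.
apply: le_trans (dnorm_mulmx_le Bpos _ _) _.
rewrite mulrAC; apply: ler_wpM2r; first exact: pnorm_ge0.
apply: le_trans (fL _ _) _; rewrite ler_pM2l //.
rewrite addrAC addrC; apply: le_trans (pnormD Bpos _ _) _.
rewrite lerD2r pnormZ ger0_norm // ler_piMl // pnorm_ge0 //.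
Qed.

Lemma grad_residual_norm x z h v :
  `|dot (grad f (x + h) - grad f x - h *m hess f z) v| <=
    L * pnorm B h * (pnorm B h + pnorm B (x - z)) * pnorm B v.
Proof.
rewrite ler_norml grad_residual andbT lerNl -dotNr.
by rewrite (le_trans (grad_residual _ _ _ _)) // pnormN.
Qed.

(** Mean value theorem for [t |-> f (x + u + t v) - f (x + t v)], then [grad_residual_norm] at the
    base point [x + c v] against the Hessian at [x]. *)
Lemma second_difference_hess x u v :
  `|f (x + u + v) - f (x + u) - f (x + v) + f x - dot (u *m hess f x) v| <=
    L * pnorm B u * pnorm B v * (pnorm B u + pnorm B v).
Proof.
have [df _ _] := fC2.
have dline y t := is_derive_line (is_derive_dot_grad v (df (y + t *: v))).
have [c /andP[c0 c1]] := MVT01 (fun t => is_deriveB (dline (x + u) t) (dline x t)).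
rewrite !fctE !scale1r !scale0r !addr0 -dotBl => E.
have -> : f (x + u + v) - f (x + u) - f (x + v) + f x =
  f (x + u + v) - f (x + v) - (f (x + u) - f x) by ring.
rewrite E -dotBl [x + u + _]addrAC.
apply: le_trans (grad_residual_norm (x + c *: v) x u v) _.
rewrite mulrAC; apply: ler_wpM2l; first by rewrite !mulr_ge0 ?pnorm_ge0 ?ltW.
rewrite lerD2l addrAC subrr add0r pnormZ ger0_norm // ler_piMl //.
exact: pnorm_ge0.
Qed.

(* Both sides agree with the second difference, which is symmetric in [u] and
   [v], up to a term cubic in [(u, v)]: rescale [(u, v)] by [t] and let [t]
   tend to 0. *)
Lemma hess_dotC x u v : dot (u *m hess f x) v = dot (v *m hess f x) u.
Proof.
apply/eqP; rewrite -subr_eq0 -normr_le0; apply/ler_addgt0Pl => e e0.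
set D := `|_|; set K := L * pnorm B u * pnorm B v * (pnorm B u + pnorm B v).
have K0 : 0 <= K by rewrite !mulr_ge0 ?addr_ge0 ?pnorm_ge0 ?ltW.
suff DK (t : R) : 0 < t -> D <= t * (2 * K).
  (* This [t] makes [t * (2 * K) <= e]; the [+ 1] covers [K = 0]. *)
  have tp : 0 < e / (2 * K + 1) by rewrite divr_gt0 //; lra.
  apply: le_trans (DK _ tp) _.
  rewrite addr0 mulrAC ler_pdivrMr; nra.
move=> t0; rewrite -(ler_pM2l (mulr_gt0 t0 t0)) -{1}(gtr0_norm (mulr_gt0 t0 t0)).
rewrite -normrM mulrBr.
have := second_difference_hess x (t *: u) (t *: v).
have := second_difference_hess x (t *: v) (t *: u).
rewrite !pnormZ -!scalemxAl !(dotZl, dotZr) (gtr0_norm t0).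
rewrite [x + t *: v + t *: u]addrAC.
move: (f _) (f _) (f _) (f _) => a b c e1.
rewrite !ler_norml => /andP[h1 h2] /andP[h3 h4].
have -> : t * t * (t * (2 * K)) = 2 * (L * (t * pnorm B u) * (t * pnorm B v) *
  (t * pnorm B u + t * pnorm B v)) by rewrite /K; ring.
by apply/andP; split; lra.
Qed.

End LipschitzHessian.

(** * The regularized Newton step *)

Section CubicStep.
Variables (R : realType) (d : nat) (B : 'M[R]_d) (f : 'rV[R]_d -> R).
Variables (L mu M : R).
Hypotheses (Bpos : posdefmx B) (fC2 : C2 f) (L0 : 0 < L).
Hypothesis fL : hess_lipschitz B L f.
Hypotheses (mu0 : 0 < mu) (fmu : strongly_convex B mu f) (M0 : 0 <= M).
Implicit Types (x y z u v h T : 'rV[R]_d).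

Lemma strongly_convex_hess x h : mu * pnorm B h ^+ 2 <= dot (h *m hess f x) h.
Proof.
rewrite pnorm_sqr // -dotZl; have := fmu x h.
by rewrite -scalemxAr.
Qed.

(** Strong monotonicity of the gradient along [y - x]. It will bound the distance to the phase start
    by gradient norms alone. *)
Lemma strongly_convex_dist x y :
  mu * pnorm B (y - x) <= dnorm B (grad f x) + dnorm B (grad f y).
Proof.
set h := y - x.
have [c _] := grad_dot_MVT fC2 x h h.
rewrite [x + h]addrC subrK => E.
have := strongly_convex_hess (x + c *: h) h.
rewrite -E dotBl -dotNr => le_mu.
have le_y := dot_le_dnorm_pnorm Bpos (grad f y) h.
have le_x := dot_le_dnorm_pnorm Bpos (grad f x) (- h).
rewrite pnormN in le_x.
have [->|nh] := eqVneq (pnorm B h) 0.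
  by rewrite mulr0 addr_ge0 ?dualnorm_ge0.
have hp : 0 < pnorm B h by rewrite lt0r nh pnorm_ge0.
by rewrite -(ler_pM2r hp); nra.
Qed.

(* With [n = |h|] and [s = |h + v|], it follows from
   [s^3 - n^3 - 3/2 n (s^2 - n^2) = (s - n)^2 (s + n/2)]. *)
Lemma pnorm_cube_le h v :
  pnorm B (h + v) ^+ 3 <= pnorm B h ^+ 3 + 3 * pnorm B h * dot (h *m B) v
    + 3 * pnorm B h * pnorm B v ^+ 2 + pnorm B v ^+ 3.
Proof.
have sqE : pnorm B (h + v) ^+ 2 =
    pnorm B h ^+ 2 + 2 * dot (h *m B) v + pnorm B v ^+ 2.
  rewrite !pnorm_sqr // mulmxDl !(dotDl, dotDr) (posdef_dotC Bpos v h); ring.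
have le1 := pnormD Bpos h v.
have := pnormD Bpos (h + v) (- v); rewrite addrK pnormN => le2.
have := pnorm_ge0 B h; have := pnorm_ge0 B v; have := pnorm_ge0 B (h + v).
move: (pnorm B (h + v)) (pnorm B h) (pnorm B v) (dot _ _) sqE le1 le2.
move=> s n w c sqE le1 le2 s0 w0 n0.
(* The triangle inequality, used both ways, gives [|s - n| <= w]. The right-hand side is
   [3/2 n w^2 + w^3]; the other [3/2 n w^2] comes from [s^2 - n^2]. *)
have sn : (s - n) ^+ 2 * (s + n / 2) <= w ^+ 2 * (n + w + n / 2).
  apply: ler_pM; [exact: sqr_ge0|lra| |lra].
  by rewrite -[leLHS]real_normK ?num_real // ler_pXn2r ?nnegrE // ler_norml; lra.
have -> : s ^+ 3 = n ^+ 3 + 3 / 2 * n * (s ^+ 2 - n ^+ 2)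
  + (s - n) ^+ 2 * (s + n / 2) by field.
rewrite sqE; apply: le_trans (lerD (lexx _) sn) _.
by rewrite le_eqVlt; apply/orP; left; apply/eqP; field.
Qed.

Lemma linear_part_eq0 (D K : R) :
  (forall t : R, `|t| <= 1 -> 0 <= t * D + t ^+ 2 * K) -> D = 0.
Proof.
move=> DK; apply/eqP; apply: contraT => D0.
(* At [t = - D / N] the quadratic equals [(D / N)^2 (K - N)], negative since [K < N]; and [|D| <= N]
   ensures [|t| <= 1]. *)
pose N := `|D| + `|K| + 1.
have [dp kp] : 0 < `|D| /\ 0 <= `|K| by rewrite normr_gt0.
have Np : 0 < N by rewrite /N; lra.
have := DK (- D / N); rewrite normrM normrN normfV (gtr0_norm Np).
rewrite ler_pdivrMr // mul1r => /(_ ltac:(rewrite /N; lra)).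
have -> : - D / N * D + (- D / N) ^+ 2 * K = (D / N) ^+ 2 * (K - N).
  by field; rewrite gt_eqF.
have DN : D / N != 0 by rewrite mulf_neq0 // invr_neq0 // gt_eqF.
rewrite pmulr_rge0; last by rewrite exprn_even_gt0.
have := ler_norm K; rewrite /N; lra.
Qed.

(** The cubic term is not differentiated: by [pnorm_cube_le], moving from [T] to [T + t v] with
    [|t| <= 1] changes the model by at most [t D + t^2 K], where [D] is the left-hand side. *)
Lemma cubic_step_stationary x z T v : is_cubic_step B M f x z T ->
  dot (grad f x + (T - x) *m hess f z) v
    + M / 2 * pnorm B (T - x) * dot ((T - x) *m B) v = 0.
Proof.
move=> xzT; set h := T - x.
pose K := 2^-1 * dot (v *m hess f z) v
  + M / 6 * (3 * pnorm B h * pnorm B v ^+ 2 + pnorm B v ^+ 3).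
apply: (@linear_part_eq0 _ K) => t t1.
have := xzT (T + t *: v); rewrite /cubic_model [T + _ - x]addrAC -/h; clearbody h.
have := pnorm_cube_le h (t *: v).
have w0 := pnorm_ge0 B v.
have t3 : (`|t| * pnorm B v) ^+ 3 <= t ^+ 2 * pnorm B v ^+ 3.
  rewrite exprMn; apply: ler_wpM2r; first exact: exprn_ge0.
  by rewrite exprSr real_normK ?num_real // ler_piMr ?sqr_ge0.
rewrite mulmxDl -scalemxAl !(dotDl, dotDr, dotZl, dotZr) pnormZ.
(* Symmetry of the Hessian merges the two cross terms of the quadratic form. *)
rewrite (hess_dotC Bpos fC2 L0 fL z v h) [(_ * _) ^+ 2]exprMn real_normK ?num_real //.
move: (pnorm B (h + t *: v)) => s s3 le_model.
have M6 : 0 <= M / 6 by rewrite divr_ge0.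
have := ler_wpM2l M6 (le_trans s3 (lerD (lexx _) t3)).
move: le_model; rewrite /K.
set a := dot (grad f x) v; set b := dot (h *m hess f z) v.
lra.
Qed.

Lemma cubic_step_dist x z T : is_cubic_step B M f x z T ->
  mu * pnorm B (T - x) <= dnorm B (grad f x).
Proof.
move=> /cubic_step_stationary - /(_ (T - x)); set h := T - x.
rewrite dotDl -(pnorm_sqr Bpos) => stat.
have le_mu := strongly_convex_hess z h.
have := dot_le_dnorm_pnorm Bpos (grad f x) (- h).
rewrite pnormN dotNr => le_x.
have [->|nh] := eqVneq (pnorm B h) 0; first by rewrite mulr0 dualnorm_ge0.
have hp : 0 < pnorm B h by rewrite lt0r nh pnorm_ge0.
have h3 : 0 <= M / 2 * pnorm B h * pnorm B h ^+ 2.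
  by rewrite !mulr_ge0 ?exprn_ge0 ?pnorm_ge0 ?divr_ge0.
by rewrite -(ler_pM2r hp); nra.
Qed.

(** By stationarity, [grad f T] is the Taylor residual of the gradient minus [M/2 |h| B h], with
    [h = T - x]. *)
Lemma cubic_step_grad x z T : is_cubic_step B M f x z T ->
  dnorm B (grad f T) <= L * pnorm B (T - x) * (pnorm B (T - x) + pnorm B (x - z))
    + M / 2 * pnorm B (T - x) ^+ 2.
Proof.
move=> xzT; apply: (dnorm_le Bpos) => [|v].
  by rewrite addr_ge0 ?mulr_ge0 ?addr_ge0 ?exprn_ge0 ?pnorm_ge0 ?divr_ge0 ?(ltW L0).
have := cubic_step_stationary v xzT.
have := grad_residual Bpos fC2 L0 fL x z (T - x) v.
have := pnorm_cauchy Bpos (T - x) (- v).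
have -> : x + (T - x) = T by rewrite addrC subrK.
rewrite pnormN dotNr !(dotDl, dotNl) mulrDl => cs res stat.
have M2 : 0 <= M / 2 by rewrite divr_ge0.
have := ler_wpM2l (mulr_ge0 M2 (pnorm_ge0 B (T - x))) cs.
have -> : M / 2 * pnorm B (T - x) ^+ 2 * pnorm B v =
  M / 2 * pnorm B (T - x) * (pnorm B (T - x) * pnorm B v) by ring.
lra.
Qed.

Lemma cubic_step_grad_le x z T a b : is_cubic_step B M f x z T ->
  dnorm B (grad f x) <= a -> dnorm B (grad f z) <= b ->
  mu ^+ 2 * dnorm B (grad f T) <= (2 * L + M / 2) * a ^+ 2 + L * a * b.
Proof.
move=> xzT xa zb; have hd := le_trans (cubic_step_dist xzT) xa.
have zd := le_trans (strongly_convex_dist z x) (lerD zb xa).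
have := ler_wpM2l (sqr_ge0 mu) (cubic_step_grad xzT).
move=> /le_trans; apply.
have := pnorm_ge0 B (T - x); have := pnorm_ge0 B (x - z).
move: (pnorm B (T - x)) (pnorm B (x - z)) hd zd => n r hd zd r0 n0.
have [mn0 mr0] : 0 <= mu * n /\ 0 <= mu * r by rewrite !mulr_ge0 // ltW.
(* The factor [mu^2] gives one [mu] to each length: [mu n <= a] and [mu r <= a + b]. Both [n^2] and
   [n r] contribute [L a^2], whence [2 * L]. *)
have nn := ler_pM mn0 mn0 hd hd; have nr := ler_pM mn0 mr0 hd zd.
have LM : 0 <= L + M / 2 by rewrite addr_ge0 ?divr_ge0 ?(ltW L0).
have := ler_wpM2l LM nn; have := ler_wpM2l (ltW L0) nr.
lra.
Qed.

End CubicStep.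

(** * Exponents along phases *)

Lemma divn_phase_start m k : (phase_start m k %/ m = k %/ m)%N.
Proof.
(* For [m = 0] both quotients take the default value 0. *)
case: m => [|m]; first by rewrite !divn0.
by rewrite /phase_start {1}(divn_eq k m.+1) addnK mulnK.
Qed.

Lemma phase_start_modn m k : (phase_start m k %% m = 0)%N.
Proof. by rewrite /phase_start {1}(divn_eq k m) addnK modnMl. Qed.

(** Inside a phase the remainder grows by one. At the end of a phase [k %% m = m - 1], so
    [2 + k %% m] is exactly the new factor [1 + m], and the remainder restarts at 0. *)
Lemma lazy_exponentS m k : (1 <= m)%N ->
  ((1 + m) ^ (phase_start m k.+1 %/ m) * (1 + k.+1 %% m) =
   (1 + m) ^ (phase_start m k %/ m) * (2 + k %% m))%N.
Proof.
move=> m1; rewrite !divn_phase_start.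
have := ltn_pmod k m1; rewrite [k.+1]lock {2 3}(divn_eq k m) -lock.
rewrite -addnS; rewrite divnMDl // modnMDl => km.
have [jm|mj] := ltnP (k %% m).+1 m.
  by rewrite (divn_small jm) (modn_small jm) addn0.
have -> : (k %% m).+1 = m by lia.
by rewrite divnn modnn m1 expnD expn1; nia.
Qed.

Theorem theorem5p1 (R : realType) (d : nat) (B : 'M[R]_d)
    (f : 'rV[R]_d -> R) (L mu M : R) (m : nat) (x : nat -> 'rV[R]_d) :
  let G0 := mu ^+ 2 / (3 * L + M) in
  posdefmx B ->
  C2 f ->
  0 < L -> hess_lipschitz B L f ->
  0 < mu -> strongly_convex B mu f ->
  0 <= M -> (1 <= m)%N ->
  lazy_cubic_newton B M m f x ->
  dnorm B (grad f (x 0%N)) <= 2^-1 * G0 ->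
  forall k : nat,
    dnorm B (grad f (x k)) <=
      G0 * 2^-1 ^+ ((1 + m) ^ (phase_start m k %/ m) * (1 + k %% m)).
Proof.
move=> G0 Bpos fC2 L0 fL mu0 fmu M0 m1 xT x0.
have D0 : 0 < 3 * L + M by lra.
have mu2 : 0 < mu ^+ 2 by rewrite exprn_gt0.
(* Strong induction: the step uses the bounds at [k] and at the start of its phase. *)
elim/ltn_ind => -[_|k IH].
  by rewrite /phase_start mod0n div0n expn0 mul1n expr1 mulrC.
rewrite lazy_exponentS //.
have := IH k (ltnSn k).
have /IH : (phase_start m k < k.+1)%N by rewrite ltnS leq_subr.
rewrite phase_start_modn addn0 muln1.
rewrite !divn_phase_start !exprM.
(* With [q] the rate at the phase start, the known bounds are [G0 q] there and [G0 q^(1+j)] at [k];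
   the goal is [G0 q^(2+j)]. *)
set q := 2^-1 ^+ _; set j := (k %% m)%N => start_le cur_le.
have q0 : 0 <= q by rewrite exprn_ge0 // invr_ge0.
have q1 : q <= 1 by rewrite exprn_ile1 ?invr_ge0 ?invf_le1 ?ler1n.
rewrite -(ler_pM2l mu2).
apply: le_trans (cubic_step_grad_le Bpos fC2 L0 fL mu0 fmu M0 (xT k) cur_le start_le) _.
have muE : mu ^+ 2 = G0 * (3 * L + M) by rewrite /G0 divfK // gt_eqF.
have p0 : 0 <= q ^+ j by rewrite exprn_ge0.
have p1 : q ^+ j <= 1 by rewrite exprn_ile1.
rewrite muE !exprS.
rewrite [leLHS](_ : _ = G0 ^+ 2 * q ^+ 2 * q ^+ j *
  ((2 * L + M / 2) * q ^+ j + L)); last by ring.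
rewrite [leRHS](_ : _ = G0 ^+ 2 * q ^+ 2 * q ^+ j * (3 * L + M)); last by ring.
apply: ler_wpM2l; first by rewrite mulr_ge0 // -exprMn sqr_ge0.
nra.
Qed.
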